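(* The Poisson manifolds $(W_2,e_1)$ and $(W_2,e_5)$, where $W_2=\mathrm{Tot}(\mathcal O_{\mathbb P^1}(-2)\oplus\mathcal O_{\mathbb P^1})$ and $e_1,e_5$ are the Poisson structures specified in the context, are isomorphic.
   Context: $W_2$ is obtained by gluing $U=\mathbb C^3_{\{z,u_1,u_2\}}$ and $V=\mathbb C^3_{\{\xi,v_1,v_2\}}$ by $(\xi,v_1,v_2)=(z^{-1},z^2u_1,u_2)$ where $z,\xi\neq0$. Write $\partial_0=\partial/\partial z$, $\partial_1=\partial/\partial u_1$, $\partial_2=\partial/\partial u_2$. The global holomorphic Poisson structures $e_1,e_5$ on $W_2$ are given on $U$ by $e_1=\partial_2\wedge\partial_0$ and $e_5=2zu_1\,\partial_1\wedge\partial_2+z^2\,\partial_2\wedge\partial_0$. Poisson manifolds $(W_2,\pi)$ and $(W_2,\pi')$ are isomorphic if there is a biholomorphism $\phi:W_2\to W_2$ with $\phi_*\pi=\pi'$. *)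

(* Defs.v *)
From HB Require Import structures.
From mathcomp Require Import all_boot all_order all_algebra.
From mathcomp Require Import all_classical all_reals.
From mathcomp Require Import topology normedtype derive.
From mathcomp Require Import complex ring.
Set Implicit Arguments.
Unset Strict Implicit.
Unset Printing Implicit Defensive.
Import Order.TTheory GRing.Theory Num.Theory.
Import numFieldNormedType.Exports.
Local Open Scope classical_set_scope.
Local Open Scope ring_scope.
Local Open Scope quotient_scope.

(* Naming R[i] at type [numFieldType] gives it the topology and norm of
   [numFieldNormedType].  With scalars in CC, [differentiable] is complex
   differentiability, hence holomorphy when it holds at each point of an open
   set, and ['D_v] is the holomorphic directional derivative. *)
Definition CC (R : realType) : numFieldType := R[i].

Notation C3 R := 'rV[CC R]_3.

Variant chart := ChartU | ChartV.

Definition bool_of_chart (a : chart) : bool :=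
  if a is ChartV then true else false.
Definition chart_of_bool (b : bool) : chart := if b then ChartV else ChartU.
Lemma bool_of_chartK : cancel bool_of_chart chart_of_bool.
Proof. by case. Qed.
HB.instance Definition _ := Choice.copy chart (can_type bool_of_chartK).

(* (z, u1, u2) |-> (z^-1, z^2 u1, u2), meaningful for z != 0 *)
Definition transition (R : realType) (x : C3 R) : C3 R :=
  \row_i [:: (x 0 0)^-1; (x 0 0) ^+ 2 * x 0 1; x 0 2]`_i.

Definition charts_union (R : realType) : topologicalType :=
  {a : chart & (fun=> C3 R) a}.

Definition glue (R : realType) : rel (charts_union R) := fun p q =>
  match tag p, tag q with
  | ChartU, ChartV =>
      (tagged p 0 0 != 0) && (tagged q == transition (tagged p))
  | ChartV, ChartU =>
      (tagged q 0 0 != 0) && (tagged p == transition (tagged q))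
  | _, _ => tagged p == tagged q
  end.

Lemma ord3P (i : 'I_3) : [\/ i = 0, i = 1 | i = 2].
Proof.
by case: i => [[|[|[|//]]] hi]; [apply: Or31|apply: Or32|apply: Or33];
  apply: val_inj.
Qed.

Lemma row3P (K : Type) (x y : 'rV[K]_3) :
  x 0 0 = y 0 0 -> x 0 1 = y 0 1 -> x 0 2 = y 0 2 -> x = y.
Proof. by move=> h0 h1 h2; apply/rowP => i; case: (ord3P i) => ->. Qed.

Section transition_theory.
Context {R : realType}.
Implicit Types x : C3 R.

Lemma transition0 x : transition x 0 0 = (x 0 0)^-1.
Proof. by rewrite mxE. Qed.

Lemma transition1 x : transition x 0 1 = (x 0 0) ^+ 2 * x 0 1.
Proof. by rewrite mxE. Qed.

Lemma transition2 x : transition x 0 2 = x 0 2.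
Proof. by rewrite mxE. Qed.

Lemma transitionK x : x 0 0 != 0 -> transition (transition x) = x.
Proof.
move=> x0; apply: row3P; rewrite !(transition0, transition1, transition2) //.
  by rewrite invrK.
by rewrite mulrA -exprMn mulVf // expr1n mul1r.
Qed.

Lemma transition_neq0 x : x 0 0 != 0 -> transition x 0 0 != 0.
Proof. by rewrite transition0 invr_eq0. Qed.

Lemma glue_refl : reflexive (@glue R).
Proof. by case=> [[] x]; rewrite /glue /=. Qed.

Lemma glue_sym : symmetric (@glue R).
Proof. by case=> [[] x] [[] y]; rewrite /glue //= eq_sym. Qed.

Lemma glue_trans : transitive (@glue R).
Proof.
move=> [b y] [a x] [c w]; rewrite /glue /=.
case: a x => x; case: b y => y; case: c w => w /=.
- by move=> /eqP-> /eqP->.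
- by move=> /eqP-> .
- by move=> /andP[x0 /eqP->] /andP[w0 /eqP/(congr1 (@transition R))];
     rewrite !transitionK // => ->.
- by move=> /andP[x0 /eqP->] /eqP<-; rewrite x0 eqxx.
- by move=> /andP[y0 /eqP->] /eqP<-; rewrite y0 eqxx.
- by move=> /andP[y0 /eqP->] /andP[_ /eqP->].
- by move=> /eqP->.
- by move=> /eqP-> /eqP->.
Qed.

End transition_theory.

Canonical glue_equiv (R : realType) :=
  EquivRel (@glue R) (@glue_refl R) (@glue_sym R) (@glue_trans R).

Definition W2 (R : realType) : topologicalType :=
  quotient_topology {eq_quot @glue R}.

Definition param (R : realType) (a : chart) (x : C3 R) : W2 R :=
  \pi_(quotient_topology {eq_quot @glue R})
    (existT (fun=> C3 R) a x : charts_union R).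

(* The inverse of [param a], extended by 0 outside of the chart. *)
Definition coord (R : realType) (a : chart) (p : W2 R) : C3 R :=
  xget 0 [set x | param a x = p].

Section param_theory.
Context {R : realType}.

Lemma param_eq a b (x y : C3 R) : param a x = param b y <->
  glue (existT (fun=> C3 R) a x : charts_union R)
       (existT (fun=> C3 R) b y : charts_union R).
Proof.
split => [/eqmodP//|h]; exact/eqmodP.
Qed.

Lemma param_continuous a : continuous (@param R a).
Proof.
move=> x; apply: (@continuous_comp _ _ _ (existT (fun=> C3 R) a)
  (\pi_(quotient_topology {eq_quot @glue R}))).
  exact: existT_continuous.
exact: pi_continuous.
Qed.

Lemma param_transition (x : C3 R) : x 0 0 != 0 ->
  param ChartU x = param ChartV (transition x).
Proof. by move=> x0; apply/param_eq; rewrite /glue /= x0 eqxx. Qed.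

Lemma param_inj a : injective (@param R a).
Proof. by case: a => x y /param_eq; rewrite /glue /= => /eqP. Qed.

Lemma paramK a : cancel (@param R a) (coord a).
Proof.
move=> x; apply: (@param_inj a); rewrite /coord.
by case: xgetP => [y _ //|/(_ x)]; case.
Qed.
End param_theory.

Definition local_expr (R : realType) (a b : chart) (phi : W2 R -> W2 R) :
  C3 R -> C3 R := coord b \o phi \o param a.

Definition holomorphic (R : realType) (phi : W2 R -> W2 R) : Prop :=
  continuous phi /\
  forall a b x, range (param b) (phi (param a x)) ->
    differentiable (local_expr a b phi) x.

Definition biholomorphism (R : realType) (phi : W2 R -> W2 R) : Prop :=
  holomorphic phi /\
  exists psi, [/\ holomorphic psi, cancel phi psi & cancel psi phi].

(* Tangent vectors are row vectors in the coordinate frame, ['e_i] being the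
   i-th coordinate field; the bivector
   \sum_(i < j) P_ij ('e_i /\ 'e_j) is the alternating matrix P. *)
Definition wedge (R : realType) (v w : C3 R) : 'M[CC R]_3 :=
  v^T *m w - w^T *m v.

(* ['J f x] acts on row vectors from the right: the differential of f at x
   is v |-> v *m 'J f x, so v /\ w is mapped to (v *m 'J f x) /\ (w *m 'J f x). *)
Definition push (R : realType) (f : C3 R -> C3 R) (x : C3 R)
    (P : 'M[CC R]_3) : 'M[CC R]_3 :=
  ('J f x)^T *m P *m 'J f x.

(* The (i, j, k) component of the Schouten bracket [P, Q] of two bivector
   fields on C^3, up to the sign convention. *)
Definition schouten (R : realType) (P Q : C3 R -> 'M[CC R]_3) (x : C3 R)
    (i j k : 'I_3) : CC R :=
  let D l (F : C3 R -> 'M[CC R]_3) i j : CC R := 'D_('e_l) (fun y => F y i j) x in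
  \sum_(l < 3)
    (P x i l * D l Q j k + P x j l * D l Q k i + P x k l * D l Q i j +
     (Q x i l * D l P j k + Q x j l * D l P k i + Q x k l * D l P i j)).

Record poisson (R : realType) := Poisson {
  bivector :> chart -> C3 R -> 'M[CC R]_3;
  bivector_alt : forall a x, (bivector a x)^T = - bivector a x;
  bivector_holomorphic : forall a i j x,
    differentiable (fun y : C3 R => bivector a y i j) x;
  bivector_glue : forall x : C3 R, x 0 0 != 0 ->
    bivector ChartV (transition x) =
    push (@transition R) x (bivector ChartU x);
  bivector_schouten : forall a x i j k,
    schouten (bivector a) (bivector a) x i j k = 0
}.

Definition pushes_to (R : realType) (phi : W2 R -> W2 R)
    (pi pi' : poisson R) : Prop :=
  forall a b x, range (param b) (phi (param a x)) ->
    pi' b (local_expr a b phi x) = push (local_expr a b phi) x (pi a x).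

Definition poisson_isomorphic (R : realType) (pi pi' : poisson R) : Prop :=
  exists phi, biholomorphism phi /\ pushes_to phi pi pi'.

(* The components on ChartV are the holomorphic continuations of the given
   formulas on ChartU; see e1_glue and e5_glue. *)
Definition e1_bivector (R : realType) (a : chart) (x : C3 R) : 'M[CC R]_3 :=
  match a with
  | ChartU => wedge 'e_2 'e_0
  | ChartV =>
      - (x 0 0 ^+ 2) *: wedge 'e_2 'e_0 + (2 * x 0 0 * x 0 1) *: wedge 'e_2 'e_1
  end.

Definition e5_bivector (R : realType) (a : chart) (x : C3 R) : 'M[CC R]_3 :=
  match a with
  | ChartU =>
      (2 * x 0 0 * x 0 1) *: wedge 'e_1 'e_2 + (x 0 0 ^+ 2) *: wedge 'e_2 'e_0
  | ChartV => - wedge 'e_2 'e_0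
  end.

Section differentials.
Context {R : realType}.
Implicit Types (x v : C3 R) (f g df dg : C3 R -> CC R).

Lemma is_diff_coord i x :
  is_diff x (fun y : C3 R => y 0 i : CC R) (fun v => v 0 i).
Proof.
have @f : {linear C3 R -> CC R}.
  by exists (fun y : C3 R => y 0 i); do 2![eexists]; do ?[constructor];
     rewrite ?mxE// => ? *; rewrite ?mxE//; move=> ?; rewrite !mxE.
apply: DiffDef; first exact: differentiable_coord.
rewrite (_ : (fun _ => _) = f) // diff_lin //; exact: coord_continuous.
Qed.

Lemma is_diff_mul f g df dg x : is_diff x f df -> is_diff x g dg ->
  is_diff x (fun y => f y * g y) (fun v => f x * dg v + g x * df v).
Proof. by move=> hf hg; exact: is_diffM. Qed.

Lemma is_diff_add f g df dg x : is_diff x f df -> is_diff x g dg ->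
  is_diff x (fun y => f y + g y) (fun v => df v + dg v).
Proof. by move=> hf hg; exact: is_diffD. Qed.

Lemma is_diff_const (c : CC R) x : is_diff x (fun=> c) (fun=> 0).
Proof. exact: is_diff_cst. Qed.

Lemma is_diff_inv f df x : is_diff x f df -> f x != 0 ->
  is_diff x (fun y => (f y)^-1) (fun v => - (f x ^- 2 * df v)).
Proof.
move=> hf fx0.
have hi : is_diff (f x) (@GRing.inv (CC R)) (fun h => - f x ^- 2 *: h).
  by apply: DiffDef; [exact: differentiable_Rinv | exact: diff_Rinv].
have hc := is_diff_comp hf hi.
apply: (is_diff_eq hc).
by apply/funext => v /=; rewrite -mulNr.
Qed.

Lemma is_diff_row (F : C3 R -> C3 R) (d : 'I_3 -> C3 R -> CC R) x :
  (forall j, is_diff x (fun y => F y 0 j : CC R) (d j)) ->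
  is_diff x F (fun v => \row_j d j v).
Proof.
move=> hF.
have h j : is_diff x (fun y => F y 0 j *: ('e_j : C3 R))
                     (fun v => d j v *: ('e_j : C3 R)).
  exact: (is_diff_comp (hF j) (is_diff_scalel _ _)).
have E (w : C3 R) : w = w 0 0 *: 'e_0 + (w 0 1 *: 'e_1 + w 0 2 *: 'e_2).
  by apply: row3P; rewrite !mxE /=; ring.
have -> : F = (fun y => F y 0 0 *: 'e_0) +
    ((fun y => F y 0 1 *: 'e_1) + (fun y => F y 0 2 *: 'e_2)).
  by apply/funext => y; rewrite {1}[F y]E.
apply: (is_diff_eq (is_diffD (h 0) (is_diffD (h 1) (h 2)))).
by apply/funext => v; rewrite [RHS]E !mxE.
Qed.

Lemma derive_is_diff f df x v : is_diff x f df -> 'D_v f x = df v.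
Proof. by move=> h; rewrite deriveE ?diff_val. Qed.

Lemma jacobian_is_diff (F dF : C3 R -> C3 R) x i j :
  is_diff x F dF -> 'J F x i j = dF 'e_i 0 j.
Proof.
by move=> h; rewrite /jacobian /lin1_mx mxE diff_val.
Qed.

Lemma is_diff_transition x : x 0 0 != 0 ->
  is_diff x (@transition R) (fun v =>
    \row_j [:: - (x 0 0 ^- 2 * v 0 0);
               x 0 0 ^+ 2 * v 0 1 + x 0 1 * (x 0 0 * v 0 0 + x 0 0 * v 0 0);
               v 0 2]`_j).
Proof.
move=> x0.
have := @is_diff_row (@transition R) (fun j v =>
  [:: - (x 0 0 ^- 2 * v 0 0);
      x 0 0 ^+ 2 * v 0 1 + x 0 1 * (x 0 0 * v 0 0 + x 0 0 * v 0 0);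
      v 0 2]`_j) x; apply=> j.
case: (ord3P j) => -> /=.
- under eq_fun do rewrite transition0.
  exact: is_diff_inv (is_diff_coord _ _) x0.
- under eq_fun do rewrite transition1.
  by do ?apply: is_diff_mul; apply: is_diff_coord.
- under eq_fun do rewrite transition2.
  exact: is_diff_coord.
Qed.

Definition table (s : seq (seq (CC R))) : 'M[CC R]_3 :=
  \matrix_(i, j) (nth [::] s i)`_j.

Lemma tableE s i j : table s i j = (nth [::] s i)`_j.
Proof. by rewrite mxE. Qed.

Lemma jacobian_transition x : x 0 0 != 0 ->
  'J (@transition R) x =
  table [:: [:: - x 0 0 ^- 2; 2 * x 0 0 * x 0 1; 0];
            [:: 0; x 0 0 ^+ 2; 0];
            [:: 0; 0; 1]].
Proof.
move=> x0; apply/matrixP => i j.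
rewrite (jacobian_is_diff i j (is_diff_transition x0)) tableE mxE.
by case: (ord3P i) => ->; case: (ord3P j) => ->; rewrite /= ?mxE /=; ring.
Qed.

Lemma wedge_alt (v w : C3 R) : (wedge v w)^T = - wedge v w.
Proof. by rewrite /wedge linearB /= !trmx_mul !trmxK opprB. Qed.

Lemma alt_comb (c d : CC R) (A B : 'M[CC R]_3) :
  A^T = - A -> B^T = - B -> (c *: A + d *: B)^T = - (c *: A + d *: B).
Proof.
by move=> hA hB; rewrite linearD 2!linearZ /= hA hB opprD 2!scalerN.
Qed.

Lemma wedgeE (v w : C3 R) i j : wedge v w i j = v 0 i * w 0 j - w 0 i * v 0 j.
Proof. by rewrite /wedge !mxE !big_ord1 !mxE. Qed.

Lemma wedge20 : wedge ('e_2 : C3 R) 'e_0 =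
  table [:: [:: 0; 0; -1]; [:: 0; 0; 0]; [:: 1; 0; 0]].
Proof.
apply/matrixP => i j; rewrite wedgeE tableE.
by case: (ord3P i) => ->; case: (ord3P j) => ->; rewrite ?mxE /=; ring.
Qed.

Lemma wedge21 : wedge ('e_2 : C3 R) 'e_1 =
  table [:: [:: 0; 0; 0]; [:: 0; 0; -1]; [:: 0; 1; 0]].
Proof.
apply/matrixP => i j; rewrite wedgeE tableE.
by case: (ord3P i) => ->; case: (ord3P j) => ->; rewrite ?mxE /=; ring.
Qed.

Lemma wedge12 : wedge ('e_1 : C3 R) 'e_2 =
  table [:: [:: 0; 0; 0]; [:: 0; 0; 1]; [:: 0; -1; 0]].
Proof.
apply/matrixP => i j; rewrite wedgeE tableE.
by case: (ord3P i) => ->; case: (ord3P j) => ->; rewrite ?mxE /=; ring.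
Qed.

Lemma addmxE (A B : 'M[CC R]_3) i j : (A + B) i j = A i j + B i j.
Proof. by rewrite mxE. Qed.

Lemma oppmxE (A : 'M[CC R]_3) i j : (- A) i j = - A i j.
Proof. by rewrite mxE. Qed.

Lemma scalemxE (c : CC R) (A : 'M[CC R]_3) i j : (c *: A) i j = c * A i j.
Proof. by rewrite mxE. Qed.

Lemma mx0E i j : (0 : 'M[CC R]_3) i j = 0.
Proof. by rewrite mxE. Qed.

Lemma frame3E (i j : 'I_3) : ('e_i : C3 R) 0 j = (j == i)%:R.
Proof. by rewrite mxE. Qed.

Definition entryE :=
  (wedge20, wedge21, wedge12, addmxE, oppmxE, scalemxE, tableE).

Lemma sum3 (F : 'I_3 -> CC R) : \sum_i F i = F 0 + F 1 + F 2.
Proof.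
rewrite !big_ord_recl big_ord0 addr0 addrA.
by congr (F _ + F _ + F _); apply: val_inj.
Qed.

Lemma pushE (F : C3 R -> C3 R) x P i j :
  push F x P i j = \sum_l \sum_k 'J F x k i * P k l * 'J F x l j.
Proof.
rewrite /push !mxE; apply: eq_bigr => l _; rewrite mxE mulr_suml.
by apply: eq_bigr => k _; rewrite mxE.
Qed.

End differentials.

Definition e1_dbivector (R : realType) (a : chart) (x v : C3 R) : 'M[CC R]_3 :=
  match a with
  | ChartU => 0
  | ChartV =>
      - (2 * x 0 0 * v 0 0) *: wedge 'e_2 'e_0
      + (2 * (x 0 0 * v 0 1 + x 0 1 * v 0 0)) *: wedge 'e_2 'e_1
  end.

Definition e5_dbivector (R : realType) (a : chart) (x v : C3 R) : 'M[CC R]_3 :=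
  match a with
  | ChartU =>
      (2 * (x 0 0 * v 0 1 + x 0 1 * v 0 0)) *: wedge 'e_1 'e_2
      + (2 * x 0 0 * v 0 0) *: wedge 'e_2 'e_0
  | ChartV => 0
  end.

Section e1_e5.
Context {R : realType}.
Implicit Types x v : C3 R.

Lemma is_diff_quadratic x (p q r : CC R) :
  is_diff x (fun y : C3 R => p * (y 0 0 * y 0 0) + q * (y 0 0 * y 0 1) + r : CC R)
    (fun v => 2 * p * (x 0 0 * v 0 0) + q * (x 0 0 * v 0 1 + x 0 1 * v 0 0)).
Proof.
have h i j := is_diff_mul (is_diff_coord i x) (is_diff_coord j x).
have hm (c : CC R) i j := is_diff_mul (is_diff_const c x) (h i j).
apply: (is_diff_eq
  (is_diff_add (is_diff_add (hm p 0 0) (hm q 0 1)) (is_diff_const r x))).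
by apply/funext => v; ring.
Qed.

Lemma e1_is_diff a x i j :
  is_diff x (fun y => e1_bivector a y i j) (fun v => e1_dbivector a x v i j).
Proof.
case: a => /=.
  by apply: (is_diff_eq (is_diff_const _ x)); apply/funext => v; rewrite mxE.
have := is_diff_quadratic x (- wedge ('e_2 : C3 R) 'e_0 i j)
                            (2 * wedge ('e_2 : C3 R) 'e_1 i j) 0.
set f := (X in is_diff x X _); set g := (X in is_diff x _ X).
suff -> : f = (fun y => e1_bivector ChartV y i j).
  suff -> : g = (fun v => e1_dbivector ChartV x v i j) by [].
  by apply/funext => v; rewrite /g /=; move: (wedge _ _) (wedge _ _) => A B;
       rewrite !mxE; ring.
by apply/funext => y; rewrite /f /=; move: (wedge _ _) (wedge _ _) => A B;
       rewrite !mxE; ring.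
Qed.

Lemma e5_is_diff a x i j :
  is_diff x (fun y => e5_bivector a y i j) (fun v => e5_dbivector a x v i j).
Proof.
case: a => /=; last first.
  by apply: (is_diff_eq (is_diff_const _ x)); apply/funext => v; rewrite mxE.
have := is_diff_quadratic x (wedge ('e_2 : C3 R) 'e_0 i j)
                            (2 * wedge ('e_1 : C3 R) 'e_2 i j) 0.
set f := (X in is_diff x X _); set g := (X in is_diff x _ X).
suff -> : f = (fun y => e5_bivector ChartU y i j).
  suff -> : g = (fun v => e5_dbivector ChartU x v i j) by [].
  by apply/funext => v; rewrite /g /=; move: (wedge _ _) (wedge _ _) => A B;
       rewrite !mxE; ring.
by apply/funext => y; rewrite /f /=; move: (wedge _ _) (wedge _ _) => A B;
       rewrite !mxE; ring.
Qed.

Lemma e1_alt a x : (e1_bivector a x)^T = - e1_bivector a x.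
Proof.
by case: a => /=; [exact: wedge_alt | apply: alt_comb; exact: wedge_alt].
Qed.

Lemma e5_alt a x : (e5_bivector a x)^T = - e5_bivector a x.
Proof.
case: a => /=; first by apply: alt_comb; exact: wedge_alt.
by rewrite linearN /= wedge_alt.
Qed.

Lemma e1_glue x : x 0 0 != 0 ->
  e1_bivector ChartV (transition x) =
  push (@transition R) x (e1_bivector ChartU x).
Proof.
move=> x0; apply/matrixP => i j.
rewrite pushE !sum3 jacobian_transition // /e1_bivector !entryE.
rewrite ?transition0 ?transition1.
by case: (ord3P i) => ->; case: (ord3P j) => -> /=; field.
Qed.

Lemma e5_glue x : x 0 0 != 0 ->
  e5_bivector ChartV (transition x) =
  push (@transition R) x (e5_bivector ChartU x).
Proof.
move=> x0; apply/matrixP => i j.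
rewrite pushE !sum3 jacobian_transition // /e5_bivector !entryE.
rewrite ?transition0 ?transition1.
by case: (ord3P i) => ->; case: (ord3P j) => -> /=; field.
Qed.

Lemma e1E x i j : e1_bivector ChartV x i j =
  (nth [::] [:: [:: 0; 0; x 0 0 ^+ 2];
    [:: 0; 0; - (2 * x 0 0 * x 0 1)];
    [:: - (x 0 0 ^+ 2); 2 * x 0 0 * x 0 1; 0]] i)`_j.
Proof.
rewrite /e1_bivector !entryE.
by case: (ord3P i) => ->; case: (ord3P j) => -> /=; ring.
Qed.

Lemma e1_dE x l i j : e1_dbivector ChartV x 'e_l i j =
  (nth [::] [:: [:: 0; 0; 2 * x 0 0 * (0 == l)%:R];
    [:: 0; 0; - (2 * (x 0 0 * (1 == l)%:R + x 0 1 * (0 == l)%:R))];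
    [:: - (2 * x 0 0 * (0 == l)%:R); 2 * (x 0 0 * (1 == l)%:R + x 0 1 * (0 == l)%:R); 0]] i)`_j.
Proof.
rewrite /e1_dbivector !entryE !frame3E.
by case: (ord3P i) => ->; case: (ord3P j) => -> /=; ring.
Qed.

Lemma e5E x i j : e5_bivector ChartU x i j =
  (nth [::] [:: [:: 0; 0; - (x 0 0 ^+ 2)];
    [:: 0; 0; 2 * x 0 0 * x 0 1];
    [:: x 0 0 ^+ 2; - (2 * x 0 0 * x 0 1); 0]] i)`_j.
Proof.
rewrite /e5_bivector !entryE.
by case: (ord3P i) => ->; case: (ord3P j) => -> /=; ring.
Qed.

Lemma e5_dE x l i j : e5_dbivector ChartU x 'e_l i j =
  (nth [::] [:: [:: 0; 0; - (2 * x 0 0 * (0 == l)%:R)];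
    [:: 0; 0; 2 * (x 0 0 * (1 == l)%:R + x 0 1 * (0 == l)%:R)];
    [:: 2 * x 0 0 * (0 == l)%:R; - (2 * (x 0 0 * (1 == l)%:R + x 0 1 * (0 == l)%:R)); 0]] i)`_j.
Proof.
rewrite /e5_dbivector !entryE !frame3E.
by case: (ord3P i) => ->; case: (ord3P j) => -> /=; ring.
Qed.

Lemma schoutenE (P : C3 R -> 'M[CC R]_3) (E : 'I_3 -> 'I_3 -> CC R)
    (dE : 'I_3 -> 'I_3 -> 'I_3 -> CC R) x i j k :
  (forall i j, P x i j = E i j) ->
  (forall l i j, 'D_('e_l) (fun y : C3 R => P y i j) x = dE l i j) ->
  schouten P P x i j k =
  \sum_l 2 * (E i l * dE l j k + E j l * dE l k i + E k l * dE l i j).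
Proof.
by move=> hE hdE; apply: eq_bigr => l _; rewrite !hE !hdE; ring.
Qed.

Lemma e1_schouten a x i j k :
  schouten (e1_bivector a) (e1_bivector a) x i j k = 0.
Proof.
have hd l u w := derive_is_diff 'e_l (e1_is_diff a x u w).
case: a hd => hd.
  rewrite (schoutenE _ _ _ (fun _ _ => erefl) hd).
  by apply: big1 => l _; rewrite /e1_dbivector !mx0E; ring.
rewrite (schoutenE _ _ _ (e1E x)
  (fun l u w => etrans (hd l u w) (e1_dE x l u w))).
rewrite sum3.
by case: (ord3P i) => ->; case: (ord3P j) => ->; case: (ord3P k) => -> /=; ring.
Qed.

Lemma e5_schouten a x i j k :
  schouten (e5_bivector a) (e5_bivector a) x i j k = 0.
Proof.
have hd l u w := derive_is_diff 'e_l (e5_is_diff a x u w).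
case: a hd => hd; last first.
  rewrite (schoutenE _ _ _ (fun _ _ => erefl) hd).
  by apply: big1 => l _; rewrite /e5_dbivector !mx0E; ring.
rewrite (schoutenE _ _ _ (e5E x)
  (fun l u w => etrans (hd l u w) (e5_dE x l u w))).
rewrite sum3.
by case: (ord3P i) => ->; case: (ord3P j) => ->; case: (ord3P k) => -> /=; ring.
Qed.

End e1_e5.

Definition e1 (R : realType) : poisson R :=
  Poisson e1_alt (fun a i j x => @ex_diff _ _ _ _ _ _ _ (e1_is_diff a x i j))
    e1_glue e1_schouten.

Definition e5 (R : realType) : poisson R :=
  Poisson e5_alt (fun a i j x => @ex_diff _ _ _ _ _ _ _ (e5_is_diff a x i j))
    e5_glue e5_schouten.

(* Main.v *)
Require Import Defs.
From mathcomp Require Import all_boot all_algebra all_classical all_reals.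
From mathcomp Require Import all_order topology normedtype landau derive.
From mathcomp Require Import complex ring.
Set Implicit Arguments.
Unset Strict Implicit.
Unset Printing Implicit Defensive.
Import Order.TTheory GRing.Theory Num.Theory.
Import numFieldNormedType.Exports.
Local Open Scope classical_set_scope.
Local Open Scope ring_scope.

(** The isomorphism exchanges the two poles of P^1.  The gluing
    (z, u1, u2) |-> (z^-1, z^2 u1, u2) is an involution, so reading the
    U-coordinates of a point as V-coordinates, and conversely, is a symmetry of
    W2.  It turns the bivector of e1 on U, namely 'e_2 /\ 'e_0, into the same
    constant bivector on V, whereas e5 is - ('e_2 /\ 'e_0) there.  Negating the
    fibre coordinate u2, which the gluing leaves alone, repairs the sign; so
    [flip] composes the exchange of charts with [reflect].

    In every chart where it is defined, [flip] is given either by the linear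
    map [reflect] or, near a point with nonzero first coordinate, by
    [reflect] composed with the transition map ([flip_localP]).  The first kind
    of expression is handled by direct computation ([push_reflect]); the second
    follows from it and the compatibility of e1 and e5 with the gluing, because
    push-forward is functorial ([push_comp]) and depends only on the germ of
    the map ([push_near]). *)

(** * Locality and functoriality of the differential *)

(** A function vanishing near x has zero differential at x; applying this to
    the difference transports the differential of f to g. *)
Lemma is_diff_near (K : numFieldType) (V W : normedModType K)
    (f g df : V -> W) (x : V) :
  {near x, f =1 g} -> is_diff x f df -> is_diff x g df.
Proof.
move=> fg fdf.
have h0 : forall y, f y = g y -> (g - f) y = 0.
  by move=> y e; rewrite -[LHS]/(g y - f y) e subrr.
have hl : (g - f) \o shift x = cst ((g - f) x) + (\0 : V -> W) +o_ 0 id.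
  apply/eqaddoP => e e0 /=.
  have fg0 : \forall h \near (0 : V), f (h + x) = g (h + x).
    by rewrite (near_shift x) /= sub0r; near=> y; rewrite /= subrK; near: y.
  near=> h; rewrite -[X in X <= _]/`|(g - f) (h + x) - ((g - f) x + 0)|.
  rewrite h0; last by near: h.
  rewrite h0; last exact: nbhs_singleton fg.
  by rewrite addr0 subrr normr0 mulr_ge0 // ltW.
have c0 : continuous (\0 : V -> W) by exact: cst_continuous.
have d0 : 'd (g - f) x = \0 :> (V -> W) by exact: diff_unique.
have gf : is_diff x (g - f) \0.
  by apply: DiffDef => //; apply/diff_locallyP; rewrite d0; split.
have -> : g = (g - f) + f by rewrite subrK.
by apply: (is_diff_eq (is_diffD gf fdf)); rewrite add0r.
Unshelve. all: by end_near. Qed.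

Section push_theory.
Context {R : realType}.
Implicit Types (f g : C3 R -> C3 R) (x : C3 R) (P : 'M[CC R]_3).

Lemma push_near f g x P : {near x, f =1 g} -> differentiable f x ->
  push f x P = push g x P.
Proof.
move=> fg /differentiableP df; have dg := is_diff_near fg df.
suff J : 'J f x = 'J g x by rewrite /push J.
apply/matrixP => i j.
exact: etrans (jacobian_is_diff i j df) (esym (jacobian_is_diff i j dg)).
Qed.

Lemma push_comp f g x P : differentiable f x -> differentiable g (f x) ->
  push (g \o f) x P = push g (f x) (push f x P).
Proof.
have dE (h : C3 R -> C3 R) y v : v *m 'J h y = 'd h y v.
  by rewrite /jacobian mul_rV_lin1.
move=> df dg; suff J : 'J (g \o f) x = 'J f x *m 'J g (f x).
  by rewrite /push J trmx_mul !mulmxA.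
have ext (A B : 'M[CC R]_3) : (forall v : C3 R, v *m A = v *m B) -> A = B.
  by move=> AB; apply/row_matrixP => i; rewrite !rowE.
apply: ext => v; apply: etrans (dE (g \o f) x v) _.
apply: etrans (congr1 (fun h => h v) (diff_comp df dg)) _.
apply: etrans (esym (dE g (f x) _)) _.
apply: etrans (congr1 (mulmx^~ _) (esym (dE f x v))) _.
exact: esym (mulmxA _ _ _).
Qed.

End push_theory.

(** * The exchange of the two charts *)

Definition swap_chart (a : chart) : chart :=
  if a is ChartU then ChartV else ChartU.

Definition reflect (R : realType) (x : C3 R) : C3 R :=
  \row_i [:: x 0 0; x 0 1; - x 0 2]`_i.

(** The representative chosen by [repr] does not matter: see [flip_param]. *)
Definition flip (R : realType) (p : W2 R) : W2 R :=
  let q : charts_union R := repr p in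
  param (swap_chart (tag q)) (reflect (tagged q)).

Section reflect_theory.
Context {R : realType}.
Implicit Types x : C3 R.

Lemma reflect0 x : reflect x 0 0 = x 0 0. Proof. by rewrite mxE. Qed.
Lemma reflect1 x : reflect x 0 1 = x 0 1. Proof. by rewrite mxE. Qed.
Lemma reflect2 x : reflect x 0 2 = - x 0 2. Proof. by rewrite mxE. Qed.
Definition reflectE := (reflect0, reflect1, reflect2).

Lemma reflectK : involutive (@reflect R).
Proof. by move=> x; apply: row3P; rewrite !reflectE ?opprK. Qed.

Lemma reflect_transition x : reflect (transition x) = transition (reflect x).
Proof.
by apply: row3P; rewrite !(reflectE, transition0, transition1, transition2).
Qed.

Lemma is_diff_reflect x : is_diff x (@reflect R) (@reflect R).
Proof.
have h := is_diff_coord ^~ x.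
apply: (@is_diff_row _ _ (fun j (v : C3 R) => [:: v 0 0; v 0 1; - v 0 2]`_j)).
move=> j; case: (ord3P j) => -> /=.
- by under eq_fun do rewrite reflect0; exact: h.
- by under eq_fun do rewrite reflect1; exact: h.
- by under eq_fun do rewrite reflect2; exact: is_diffN.
Qed.

Lemma differentiable_reflect x : differentiable (@reflect R) x.
Proof. by have [] := is_diff_reflect x. Qed.

Lemma differentiable_transition x : x 0 0 != 0 ->
  differentiable (@transition R) x.
Proof. by move=> /is_diff_transition[]. Qed.

Lemma jacobian_reflect x : 'J (@reflect R) x =
  table [:: [:: 1; 0; 0]; [:: 0; 1; 0]; [:: 0; 0; -1]].
Proof.
apply/matrixP => i j.
rewrite (jacobian_is_diff i j (is_diff_reflect x)) tableE mxE !frame3E.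
by case: (ord3P i) => ->; case: (ord3P j) => ->; rewrite /= ?oppr0.
Qed.

Lemma push_reflect a x :
  push (@reflect R) x (e1 R a x) = e5 R (swap_chart a) (reflect x).
Proof.
apply/matrixP => i j; rewrite pushE !sum3 jacobian_reflect.
case: a; rewrite /= /e1_bivector /e5_bivector !entryE ?reflectE;
  by case: (ord3P i) => ->; case: (ord3P j) => -> /=; ring.
Qed.

End reflect_theory.

Section flip_theory.
Context {R : realType}.
Implicit Types (x y : C3 R) (p : W2 R).

Lemma param_swap a x : x 0 0 != 0 ->
  param (swap_chart a) x = param a (transition x).
Proof.
case: a => x0 /=; last exact: param_transition.
by rewrite param_transition ?transitionK ?transition_neq0.
Qed.

Lemma param_swap_neq0 a x y : param (swap_chart a) x = param a y -> x 0 0 != 0.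
Proof.
case: a => /param_eq; rewrite /glue /= => /andP[y0 /eqP] //= ->.
by rewrite transition_neq0.
Qed.

(** Well-definedness of [flip]: on the overlap, it holds because [reflect]
    commutes with the transition map, which is an involution. *)
Lemma param_reflect a b x y : param a x = param b y ->
  param (swap_chart a) (reflect x) = param (swap_chart b) (reflect y).
Proof.
have swap_neq c d : c = d \/ c = swap_chart d.
  by case: c; case: d; [left|right|right|left].
have [<- /param_inj -> //|-> e] := swap_neq a b.
have x0 := param_swap_neq0 e.
move: e; rewrite param_swap // => /param_inj <-.
have -> : swap_chart (swap_chart b) = b by case: (b).
by rewrite reflect_transition param_swap ?transitionK ?transition_neq0
  ?reflect0.
Qed.

Lemma flip_param a x :
  flip (param a x) = param (swap_chart a) (reflect x).
Proof.
apply: param_reflect; rewrite -[RHS]reprK /param.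
by case: (repr _).
Qed.

Lemma flipK : involutive (@flip R).
Proof.
move=> p; have [a [x <-]] : exists a x, param a x = p.
  case E : (repr p : charts_union R) => [a x]; exists a, x.
  by rewrite /param -E reprK.
by rewrite !flip_param reflectK; case: a.
Qed.

Lemma flip_continuous : continuous (@flip R).
Proof.
apply/quotient_continuous.
rewrite (_ : _ \o _ = fun q : charts_union R =>
    param (swap_chart (tag q)) (reflect (tagged q))); last first.
  by apply/funext => -[a x]; exact: flip_param.
apply: (@sigT_continuous _ (fun=> C3 R) _
  (fun a => param (swap_chart a) \o @reflect R)) => a x.
apply: continuous_comp; last exact: param_continuous.
exact/differentiable_continuous/differentiable_reflect.
Qed.

(** The local expressions of [flip].  The second case holds near x only: where
    the first coordinate vanishes, [flip] leaves the chart and [coord] returns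
    a default value. *)
Variant flip_local a x : chart -> (C3 R -> C3 R) -> Prop :=
| FlipSwap : flip_local a x (swap_chart a) (@reflect R)
| FlipSame f of x 0 0 != 0 & {near x, @transition R \o @reflect R =1 f} :
    flip_local a x a f.

Lemma flip_localP a b x : range (param b) (flip (param a x)) ->
  flip_local a x b (local_expr a b (@flip R)).
Proof.
case=> y _; rewrite flip_param => /esym e.
have [-> | E] : b = swap_chart a \/ b = a.
  by case: (a); case: (b); [right|left|left|right].
  rewrite (_ : local_expr _ _ _ = @reflect R); first exact: FlipSwap.
  by apply/funext => z; rewrite /local_expr /= flip_param paramK.
rewrite {b}E in e *; have := param_swap_neq0 e; rewrite reflect0 => x0.
apply: FlipSame => //.
have : \forall z \near x, (z : C3 R) 0 0 != 0.
  exact: (@cvgr_neq0 _ (CC R) _ (nbhs x) _ (fun z => z 0 0) (x 0 0)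
    (@coord_continuous _ _ _ 0 0 x)).
apply: filterS => z z0.
by rewrite /local_expr /= flip_param param_swap ?reflect0 // paramK.
Qed.

Lemma flip_holomorphic : holomorphic (@flip R).
Proof.
split=> [|a b x]; first exact: flip_continuous.
case/flip_localP => [|f x0 near_f]; first exact: differentiable_reflect.
have s0 : reflect x 0 0 != 0 by rewrite reflect0.
have := differentiable_comp (differentiable_reflect x)
  (differentiable_transition s0).
by move=> /differentiableP/(is_diff_near near_f)[].
Qed.

End flip_theory.

Theorem lemma4p2 (R : realType) : poisson_isomorphic (e1 R) (e5 R).
Proof.
exists (@flip R); split.
  split; first exact: flip_holomorphic.
  by exists (@flip R); split; [exact: flip_holomorphic| exact: flipK..].
move=> a b x /flip_localP[|f x0 near_f]; first by rewrite push_reflect.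
have s0 : reflect x 0 0 != 0 by rewrite reflect0.
have t0 := differentiable_transition x0.
have ts0 := differentiable_transition s0.
have r0 := @differentiable_reflect R.
have dtr : differentiable (@transition R \o @reflect R) x.
  exact: (differentiable_comp (r0 x) ts0).
apply: etrans _ (push_near _ near_f dtr).
apply: etrans (congr1 (e5 R a) (esym (nbhs_singleton near_f))) _.
case: a.
- (* The gluing identity goes from U to V, so the transition has to come
     first; on V, below, it has to come last. *)
  have -> : @transition R \o @reflect R = @reflect R \o @transition R.
    by apply/funext => y /=; rewrite reflect_transition.
  apply: etrans _ (esym (push_comp _ t0 (r0 _))).
  by rewrite -(bivector_glue (e1 R) x0) push_reflect.
- apply: etrans _ (esym (push_comp _ (r0 _) ts0)).
  by rewrite push_reflect; exact: (bivector_glue (e5 R) s0).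
Qed.
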